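(* Let $r$ be a positive integer or $r=\infty$, let $k\in\mathbb{N}$ with $k\le r$, and let $\boldsymbol{\lambda}$ be a partition of length at most $k$. Then $$\Big(\sum_{i\in\mathbb{Z}}z^iu_i\wedge\Phi^r_{-1,\boldsymbol{\lambda}}\Big)\otimes_{\mathbb{Q}}1_{B_r}=\frac{1}{E_r(z)}\cdot\exp\!\left(\frac{t}{z}\right)\wedge\Phi^r_{-1,\boldsymbol{\lambda}},$$ i.e., in terms of the coefficients of $\Phi^r_0$ (see the context), $\sum_{i\in\mathbb{Z}}[u_i\wedge\Phi^r_{-1,\boldsymbol{\lambda}}]\,z^i=\frac{1}{E_r(z)}\sum_{n\ge0}\frac{1}{z^n}\Big[\frac{t^n}{n!}\wedge\Phi^r_{-1,\boldsymbol{\lambda}}\Big]$.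
   Context: Let $r\in\{1,2,3,\dots\}\cup\{\infty\}$. $B_r=\mathbb{Q}[e_i : i\in\mathbb{N},\ 1\le i\le r]$ is a polynomial ring; $e_0=1$ and $e_i=0$ for $i>r$. $E_r(t)=1+\sum_{1\le i\le r}(-1)^ie_it^i\in B_r[[t]]$, and $(h_n)_{n\in\mathbb{Z}}$ is defined by $\sum_{n\in\mathbb{Z}}h_nt^n=1/E_r(t)$ (so $h_n=0$ for $n<0$, $h_0=1$). For $j\in\mathbb{Z}$ let $u_j=\sum_{n\ge0}h_{n+j}\frac{t^n}{n!}\in B_r[[t]]$ (linearly independent over $\mathbb{Q}$). Semi-infinite exterior monomials $u_{i_0}\wedge u_{i_1}\wedge\cdots$ (with $i_{m+1}=i_m-1$ for all large $m$) are formal symbols over $\mathbb{Q}$, alternating in their entries. Put $\Phi^r_{i,\boldsymbol{\lambda}}=u_{i+\lambda_1}\wedge u_{i-1+\lambda_2}\wedge u_{i-2+\lambda_3}\wedge\cdots$ (with $\lambda_m=0$ beyond the length of $\boldsymbol{\lambda}$), $\Phi^r_0=\Phi^r_{0,(0)}$. For $\phi=\sum_{n\ge0}a_n\frac{t^n}{n!}\in B_r[[t]]$ and $k\in\mathbb{N}$ let $U_k(\phi)=a_k+\sum_{i\ge1}(-1)^ie_ia_{k-i}$, where $a_j=0$ for $j<0$; then $\phi=\sum_{i\ge0}U_i(\phi)u_{-i}$. For a monomial $\alpha=u_{i_0}\wedge u_{i_1}\wedge\cdots$ with $i_m=-m$ for all $m\ge k$, the element $\alpha\otimes_{\mathbb{Q}}1_{B_r}$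 is $[\alpha]\,\Phi^r_0\in B_r\Phi^r_0$, where $[\alpha]=\det\big(U_a(u_{i_b})\big)_{0\le a,b\le k-1}\in B_r$ (independent of $k$; this is the result of expanding each $u_{i_b}$ $B_r$-linearly in the $u_{-a}$, $a\ge0$). For $v\in B_r[[t]]$, $v\wedge\Phi^r_{-1,\boldsymbol{\lambda}}$ is defined $B_r$-linearly: $[v\wedge\Phi^r_{-1,\boldsymbol{\lambda}}]=\sum_{i\ge0}U_i(v)\,[u_{-i}\wedge\Phi^r_{-1,\boldsymbol{\lambda}}]$, a finite sum because $u_{-i}\wedge\Phi^r_{-1,\boldsymbol{\lambda}}=0$ for $i$ large. All operations are extended coefficientwise to series in $z,z^{-1}$; $\exp(t/z)=\sum_{n\ge0}z^{-n}t^n/n!$. *)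

(* Defs.v *)
From mathcomp Require Import all_boot all_order all_algebra.
From mathcomp Require Import finmap zify.
From mathcomp Require Import boolp classical_sets functions fsbigop.
From mathcomp.multinomials Require Import monalg.

Set Implicit Arguments.
Unset Strict Implicit.
Unset Printing Implicit Defensive.

Import GRing.Theory.

Local Open Scope ring_scope.

(* A formal power series is the sequence of its coefficients (at t ^ n, not at
   t ^ n / n!). *)
Definition pseries (R : Type) : Type := nat -> R.

Definition psmul (R : pzRingType) (f g : pseries R) : pseries R :=
  fun n => \sum_(i < n.+1) f i * g (n - i)%N.

Definition ps1 (R : pzRingType) : pseries R := fun n => (n == 0%N)%:R.

(* The first n.+1 coefficients of 1 / f, for f with constant coefficient 1. *)
Fixpoint psinv_seq (R : pzRingType) (f : pseries R) (n : nat) : seq R :=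
  if n is m.+1 then
    let s := psinv_seq f m in rcons s (- \sum_(i < n) f i.+1 * s`_(m - i)%N)
  else [:: 1].

Definition psinv (R : pzRingType) (f : pseries R) : pseries R :=
  fun n => (psinv_seq f n)`_n.

Lemma psmul_psinv (R : pzRingType) (f : pseries R) :
  f 0%N = 1 -> psmul f (psinv f) = @ps1 R.
Proof.
move=> f0; have szs n : size (psinv_seq f n) = n.+1.
  by elim: n => //= n IH; rewrite size_rcons IH.
have sE n m : (m <= n)%N -> (psinv_seq f n)`_m = psinv f m.
  elim: n => [|n IH]; first by rewrite leqn0 => /eqP->.
  rewrite leq_eqVlt => /predU1P[->//|]; rewrite ltnS => le_mn.
  by rewrite /= nth_rcons szs ltnS le_mn IH.
apply/funext => -[|n]; first by rewrite /psmul big_ord1 f0 mul1r.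
rewrite /psmul big_ord_recl f0 mul1r subn0.
have -> : psinv f n.+1 = - \sum_(i < n.+1) f i.+1 * psinv f (n - i)%N.
  rewrite {1}/psinv /= nth_rcons szs ltnn eqxx; apply: congr1.
  by apply: eq_bigr => i _; rewrite sE ?leq_subr.
by rewrite addrC; apply/eqP; rewrite subr_eq0; apply/eqP/eq_bigr.
Qed.

(* A series in z and z^-1 is the family of its coefficients at z ^ p. *)
Definition zseries (T : Type) : Type := int -> T.

Definition zseries_of (R : pzRingType) (f : pseries R) : zseries R :=
  fun p => if p is Posz n then f n else 0.

(* If infinitely many f p * g (i - p) are nonzero, the coefficient at z ^ i is
   a junk 0; there are finitely many when f is supported in p >= 0 and g is
   finitely supported. *)
Definition zmul (R : pzRingType) (f g : zseries R) : zseries R :=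
  fun i => \sum_(p \in [set: int]) f p * g (i - p).

(* None encodes r = oo. *)
Definition rank : Type := option nat.

Definition le_rank (k : nat) (r : rank) : bool :=
  if r is Some n then (k <= n)%N else true.

Notation eindex r := {i : nat | (0 < i)%N && le_rank i r}.

Notation B r := {malg rat[{cmonom (eindex r)}]}.

Definition e (r : rank) (i : nat) : B r :=
  if i == 0%N then 1
  else if insub i is Some j then << ucm (j : eindex r) >> else 0.

Definition E (r : rank) : pseries (B r) := fun i => (-1) ^+ i * e r i.

Definition h (r : rank) : zseries (B r) := zseries_of (psinv (E r)).

Definition u (r : rank) (j : int) : pseries (B r) :=
  fun n => (n`!%:R^-1 : rat) *: h r (n%:Z + j).

(* t ^ n / n! *)
Definition tdiv (r : rank) (n : nat) : pseries (B r) :=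
  fun m => if m == n then (n`!%:R^-1 : rat)%:A else 0.

(* The a_n such that phi is the sum of the a_n t ^ n / n! *)
Definition egf_coef (r : rank) (phi : pseries (B r)) (n : nat) : B r :=
  phi n *+ n`!.

Definition U (r : rank) (k : nat) (phi : pseries (B r)) : B r :=
  egf_coef phi k
  + \sum_(1 <= i < k.+1) (-1) ^+ i * e r i * egf_coef phi (k - i)%N.

(* The monomial u_(i_0) /\ u_(i_1) /\ ... is encoded by its sequence of
   subscripts. *)
Definition monomial : Type := nat -> int.

(* u_j /\ alpha *)
Definition wedge (j : int) (alpha : monomial) : monomial :=
  fun m => if m is m'.+1 then alpha m' else j.

Definition is_partition (lambda : seq nat) : bool :=
  sorted geq lambda && (0%N \notin lambda).

Definition Phi (i : int) (lambda : seq nat) : monomial :=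
  fun m => i - m%:Z + (nth 0%N lambda m)%:Z.

Definition vacuum_from (k : nat) (alpha : monomial) : Prop :=
  forall m, (k <= m)%N -> alpha m = - m%:Z.

(* Every phi is the sum of the U a phi * u_(-a) over a >= 0: this expands each
   u_(alpha b) accordingly. *)
Definition bracket_at (r : rank) (k : nat) (alpha : monomial) : B r :=
  \det (\matrix_(a < k, b < k) U a (u r (alpha b))).

(* alpha (x) 1 = bracket r alpha * Phi_0 in the free rank one module B_r Phi_0.
   This is the common value of the bracket_at r k alpha for the k such that
   vacuum_from k alpha (see bracketE), and a junk 0 if there is no such k. *)
Definition bracket (r : rank) (alpha : monomial) : B r :=
  xget 0 [set d | exists2 k, vacuum_from k alpha & d = bracket_at r k alpha].

Lemma E0 r : E r 0%N = 1.
Proof. by rewrite /E /e eqxx mulr1. Qed.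

Lemma U_u (r : rank) (a b : nat) : U a (u r (- b%:Z)) = (a == b)%:R.
Proof.
have egfE n : egf_coef (u r (- b%:Z)) n = h r (n%:Z - b%:Z).
  rewrite /egf_coef /u -scaler_nat scalerA mulfV ?scale1r//.
  by rewrite (Num.Theory.pnatr_eq0 rat) -lt0n fact_gt0.
have -> : U a (u r (- b%:Z)) =
    \sum_(i < a.+1) E r i * h r ((a - i)%N%:Z - b%:Z).
  rewrite /U egfE big_ord_recl E0 mul1r subn0; congr (_ + _).
  by rewrite big_add1 /= big_mkord; apply: eq_bigr => i _; rewrite egfE.
have hneg (n : nat) : (n < b)%N -> h r (n%:Z - b%:Z) = 0.
  rewrite -ltz_nat -Num.Theory.subr_lt0; by case: (n%:Z - b%:Z).
have [lt_ab|le_ba] := ltnP a b.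
  rewrite ltn_eqF//; apply: big1 => i _; rewrite hneg ?mulr0//.
  by rewrite (leq_ltn_trans (leq_subr _ _)).
have /(congr1 (@^~ (a - b)%N)) := psmul_psinv (E0 r); rewrite /psmul /ps1.
rewrite subn_eq0 eqn_leq le_ba andbT => <-.
rewrite -(big_mkord xpredT (fun i => E r i * h r ((a - i)%N%:Z - b%:Z))).
rewrite (big_cat_nat (n := (a - b).+1))//= ?ltnS ?leq_subr//.
rewrite [X in _ + X]big_nat_cond [X in _ + X]big1 ?addr0; last first.
  by move=> i; rewrite andbT => Hi; rewrite hneg ?mulr0//; lia.
rewrite big_mkord; apply: eq_bigr => -[i /= lti] _; congr (_ * _).
by have -> : (a - i)%N%:Z - b%:Z = (a - b - i)%N%:Z by lia.
Qed.

Lemma bracket_atS (r : rank) (k : nat) (alpha : monomial) :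
  vacuum_from k alpha -> bracket_at r k.+1 alpha = bracket_at r k alpha.
Proof.
move=> vac; rewrite /bracket_at (expand_det_col _ ord_max) (bigD1 ord_max)//=.
rewrite big1 ?addr0 => [|i nei]; last first.
  by rewrite mxE vac// U_u (_ : (i == k :> nat) = false) ?mul0r//; exact: negbTE.
rewrite mxE vac// U_u eqxx mul1r /cofactor exprD -expr2 sqrr_sign mul1r.
by congr (\det _); apply/matrixP => i j; rewrite !mxE !lift_max.
Qed.

Lemma bracketE (r : rank) (k : nat) (alpha : monomial) :
  vacuum_from k alpha -> bracket r alpha = bracket_at r k alpha.
Proof.
have mono m n : vacuum_from m alpha ->
    bracket_at r (n + m) alpha = bracket_at r m alpha.
  move=> vac; elim: n => // n <-; rewrite addSn bracket_atS// => p le.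
  by rewrite vac// (leq_trans _ le)// leq_addl.
move=> vac; rewrite /bracket; case: xgetP => [d _ [m vacm ->]|/(_ _)]; last first.
  by move=> /(_ (bracket_at r k alpha)) []; exists k.
by rewrite -(mono m k vacm) addnC mono.
Qed.

(* v /\ alpha, for a power series v, when vacuum_from k (wedge j alpha) for some
   k and j: then U i v is multiplied by 0 for i >= k and the sum is finite. *)
Definition bracket_ps (r : rank) (v : pseries (B r)) (alpha : monomial) : B r :=
  \sum_(i \in [set: nat]) U i v * bracket r (wedge (- i%:Z) alpha).

(* exp (t / z) *)
Definition exp_tz (r : rank) : zseries (pseries (B r)) :=
  fun p => if p <= 0 then tdiv r `|p|%N else fun=> 0.

(* Main.v *)
(* Expanding the determinant along its first column gives
   [u_j /\ alpha] = \sum_(a < K) U_a(u_j) C_a with cofactors C_a that do not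
   depend on j, whence also [v /\ alpha] = \sum_(a < K) U_a(v) C_a for every
   series v.  So only the series \sum_i z ^ i U_a(u_i) has to be compared with
   1 / E(z) * U_a(exp (t / z)): since U_a(t ^ n / n!) = E_(a - n), both have the
   coefficient \sum_(j <= a) E_j h_(i + a - j) at z ^ i. *)
Require Import Defs.
From mathcomp Require Import all_boot all_order all_algebra.
From mathcomp Require Import finmap boolp classical_sets fsbigop.
From mathcomp Require Import zify.
From mathcomp.multinomials Require Import monalg.

Set Implicit Arguments.
Unset Strict Implicit.
Unset Printing Implicit Defensive.

Import GRing.Theory.

Local Open Scope ring_scope.

(** Serves for both infinite sums, the one over [nat] in [bracket_ps] and the one over [int] in
    [zmul]: a bound on the support rules out the junk value. *)
Lemma fsbig_inj_ord (T : choiceType) (R : nmodType) (n : nat) (g : nat -> T)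
    (F : T -> R) :
  injective g -> (forall x, F x != 0 -> exists2 m, (m < n)%N & x = g m) ->
  \sum_(x \in [set: T]) F x = \sum_(m < n) F (g m).
Proof.
move=> g_inj suppF.
have uniq_s : uniq [seq g m | m <- iota 0 n] by rewrite map_inj_uniq ?iota_uniq.
rewrite -(big_mkord xpredT (fun m => F (g m))) /index_iota subn0.
rewrite -(big_map g xpredT F) (fsbig_seq _ _ uniq_s).
apply/esym/fsbig_widen => // x [_ /= x_notin].
apply: contrapT => /eqP /suppF [m lt_mn xE]; apply: x_notin.
by rewrite xE map_f// mem_iota.
Qed.

(** Cofactors along column 0 delete that column, so [G] may be chosen freely there. *)
Lemma expand_det_col0 (R : comNzRingType) (n : nat)
    (F G : 'I_n.+1 -> 'I_n.+1 -> R) :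
  (forall a b, b != ord0 -> F a b = G a b) ->
  \det (\matrix_(a, b) F a b) =
  \sum_a F a ord0 * cofactor (\matrix_(a, b) G a b) a ord0.
Proof.
move=> eqFG; rewrite (expand_det_col _ ord0); apply: eq_bigr => a _.
rewrite mxE; congr (_ * (_ * \det _)); apply/matrixP => b c; rewrite !mxE.
by rewrite eqFG// eq_sym neq_lift.
Qed.

Lemma UE (r : rank) (a : nat) (phi : pseries (B r)) :
  U a phi = \sum_(j < a.+1) E r j * egf_coef phi (a - j).
Proof.
rewrite /U big_ord_recl E0 mul1r subn0; congr (_ + _).
by rewrite big_add1 /= big_mkord.
Qed.

Lemma factK (r : rank) (n : nat) (x : B r) :
  ((n`!%:R^-1 : rat) *: x) *+ n`! = x.
Proof.
rewrite -scaler_nat scalerA mulfV ?scale1r//.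
by rewrite (Num.Theory.pnatr_eq0 rat) -lt0n fact_gt0.
Qed.

Lemma egf_coef_u (r : rank) (j : int) (n : nat) :
  egf_coef (u r j) n = h r (n%:Z + j).
Proof. exact: factK. Qed.

Lemma egf_coef_exp_tz (r : rank) (p : int) (n : nat) :
  egf_coef (exp_tz r p) n = (p == - n%:Z)%:R.
Proof.
rewrite /egf_coef /exp_tz; case: ifPn => [p_le0|p_gt0]; last first.
  by rewrite mul0rn (_ : (p == _) = false)//; apply/negbTE; lia.
rewrite /tdiv; have [->|n_neq] := eqVneq n `|p|%N.
  by rewrite factK (_ : (p == _) = true)//; apply/eqP; lia.
by rewrite mul0rn (_ : (p == _) = false)//; apply/negbTE; lia.
Qed.

Lemma U_exp_tz_eq0 (r : rank) (a : nat) (p : int) :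
  (forall m, (m <= a)%N -> p != - m%:Z) -> U a (exp_tz r p) = 0.
Proof.
move=> pN; rewrite UE big1// => j _.
by rewrite egf_coef_exp_tz (negbTE (pN _ (leq_subr _ _))) mulr0.
Qed.

(** The left side is the coefficient at [z ^ i] of 1 / E(z) times U_a(exp (t / z)), which has no
    terms beyond [m = a]. *)
Lemma sum_h_U_exp_tz (r : rank) (a n : nat) (i : int) : (a < n)%N ->
  \sum_(m < n) h r (i + m%:Z) * U a (exp_tz r (- m%:Z)) = U a (u r i).
Proof.
move=> lt_an.
under eq_bigr => m _ do rewrite UE big_distrr /=.
rewrite exchange_big UE; apply: eq_bigr => j _ /=.
(* For fixed [j], only the term [m = a - j] survives. *)
have lt_ajn : (a - j < n)%N by rewrite (leq_ltn_trans (leq_subr _ _)).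
rewrite (bigD1 (Ordinal lt_ajn))//= big1 => [|m m_neq].
  by rewrite addr0 egf_coef_exp_tz eqxx mulr1 egf_coef_u mulrC addrC.
rewrite egf_coef_exp_tz (_ : (_ == _) = false) ?mulr0//.
rewrite eqr_opp eqz_nat; exact: negbTE.
Qed.

(** Prepending [j] shifts positions by one, which the charge -1 compensates. *)
Lemma vacuum_wedge_Phi (j : int) (lambda : seq nat) :
  vacuum_from (size lambda).+1 (wedge j (Phi (-1) lambda)).
Proof.
move=> [//|m] le_lm; rewrite /= /Phi nth_default//; lia.
Qed.

Lemma bracket_wedge_expansion (r : rank) (n : nat) (alpha : monomial) :
  (forall j, vacuum_from n.+1 (wedge j alpha)) ->
  exists C : 'I_n.+1 -> B r,
    forall j, bracket r (wedge j alpha) = \sum_(a < n.+1) U a (u r j) * C a.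
Proof.
move=> vac.
(* The subscript 0 is irrelevant: a cofactor of column 0 does not see it. *)
exists (cofactor (\matrix_(a, b < n.+1) U a (u r (wedge 0 alpha b))) ^~ ord0).
move=> j; have wedgeE (b : 'I_n.+1) :
    b != ord0 -> wedge j alpha b = wedge 0 alpha b by case: b => [[]].
rewrite (bracketE r (vac j)) /bracket_at.
by apply: expand_det_col0 => a b /wedgeE ->.
Qed.

Section WedgeExpansion.

Variables (r : rank) (n : nat) (alpha : monomial) (C : 'I_n.+1 -> B r).
Hypothesis bracket_wedgeE :
  forall j, bracket r (wedge j alpha) = \sum_(a < n.+1) U a (u r j) * C a.

(** Since U_a(u_(-i)) is a Kronecker delta, this is C_i, or 0 when [i > n]; the filtered sum covers
    both cases without a cast to an ordinal. *)
Lemma bracket_wedge_neg (i : nat) :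
  bracket r (wedge (- i%:Z) alpha) = \sum_(a < n.+1 | a == i :> nat) C a.
Proof.
rewrite bracket_wedgeE [RHS]big_mkcond; apply: eq_bigr => a _; rewrite U_u.
by case: ifP => _; rewrite ?mul1r ?mul0r.
Qed.

Lemma bracket_ps_wedge (v : pseries (B r)) :
  bracket_ps v alpha = \sum_(a < n.+1) U a v * C a.
Proof.
rewrite /bracket_ps (fsbig_inj_ord (n := n.+1) (g := id)); last 2 first.
- by [].
- move=> i; have [lt_in _|le_ni] := ltnP i n.+1; first by exists i.
  rewrite bracket_wedge_neg big_pred0 ?mulr0 ?eqxx// => a.
  by rewrite ltn_eqF// (leq_trans (ltn_ord a)).
apply: eq_bigr => a _; congr (_ * _).
by rewrite bracket_wedge_neg (eq_bigl (pred1 a)) ?big_pred1_eq.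
Qed.

Lemma bracket_wedge_exp_tz (i : int) :
  bracket r (wedge i alpha) =
  zmul (h r) (fun p => bracket_ps (exp_tz r p) alpha) i.
Proof.
(* The substitution [p = i + m] turns the exponent [i - p] of exp (t / z) into [- m]. *)
rewrite /zmul (fsbig_inj_ord (n := n.+1) (g := fun m => i + m%:Z)).
- rewrite bracket_wedgeE.
  under [RHS]eq_bigr => m _ do rewrite bracket_ps_wedge big_distrr /=.
  rewrite exchange_big; apply: eq_bigr => a _ /=.
  rewrite -(sum_h_U_exp_tz r i (ltn_ord a)) big_distrl /=.
  by apply: eq_bigr => m _; rewrite mulrA opprD addNKr.
- by move=> m m' /addrI [].
(* Unless [i - p = - m] with [m <= n], every U_a with [a <= n] kills the coefficient of exp (t /
   z). *)
move=> p; rewrite bracket_ps_wedge => neq0; apply: contrapT => pN.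
move/eqP: neq0; apply; rewrite big1 ?mulr0// => a _.
rewrite U_exp_tz_eq0 ?mul0r// => m le_ma; apply/eqP => pE; apply: pN.
by exists m; [exact: leq_ltn_trans (ltn_ord a) | lia].
Qed.

End WedgeExpansion.

Theorem proposition6p3 (r : rank) (k : nat) (lambda : seq nat)
    (hr : le_rank 1 r) (hk : le_rank k r)
    (hlambda : is_partition lambda) (hlen : (size lambda <= k)%N) :
  (fun i : int => bracket r (wedge i (Phi (-1) lambda))) =
  zmul (zseries_of (psinv (E r)))
       (fun p : int => bracket_ps (exp_tz r p) (Phi (-1) lambda)).
Proof.
have [C bracketC] :=
  bracket_wedge_expansion r (vacuum_wedge_Phi ^~ lambda).
(* [h r] is by definition the series 1 / E(z). *)
apply/funext => i; exact: bracket_wedge_exp_tz bracketC i.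
Qed.
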